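(* Let $(X_t)_{t\ge0}$ be a $2$-dimensional Cauchy process with infinitesimal generator $(A,\mathcal{D}(A))$. Then there exists a function $f\in\mathcal{D}(A)$ which is not Lipschitz continuous.
   Context: The $2$-dimensional Cauchy process is the isotropic $1$-stable Lévy process in $\mathbb{R}^2$, i.e. the Lévy process with $\mathbb{E}\exp(i\xi\cdot X_t)=\exp(-t|\xi|)$, $t\ge0$, $\xi\in\mathbb{R}^2$. $C_\infty(\mathbb{R}^2)$ is the space of continuous functions $\mathbb{R}^2\to\mathbb{R}$ vanishing at infinity. With $P_tf(x)=\mathbb{E}f(x+X_t)$, the generator is: $\mathcal{D}(A)$ is the set of $f\in C_\infty(\mathbb{R}^2)$ for which there is $g\in C_\infty(\mathbb{R}^2)$ with $\lim_{t\to0}\|t^{-1}(P_tf-f)-g\|_\infty=0$, and then $Af:=g$. *)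

(* Defs.v *)
From HB Require Import structures.
From mathcomp Require Import all_boot all_order all_algebra.
From mathcomp Require Import complex.
From mathcomp Require Import all_classical all_reals all_analysis.

Set Implicit Arguments.
Unset Strict Implicit.
Unset Printing Implicit Defensive.

Import Order.TTheory GRing.Theory Num.Theory.
Import numFieldNormedType.Exports.

Local Open Scope classical_set_scope.
Local Open Scope ring_scope.
Local Open Scope complex_scope.

(* The plane is [R * R], with its product topology and product sigma-algebra
   (the usual topology and the Borel sets). The library norm on a product is
   the max norm, so the Euclidean norm is defined here. *)
Definition dot {R : realType} (x y : R * R) : R := x.1 * y.1 + x.2 * y.2.

Definition enorm {R : realType} (x : R * R) : R := Num.sqrt (dot x x).

Definition mutually_independent d (Omega : measurableType d)
    d' (E : measurableType d') (R : realType) (P : probability Omega R)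
    (n : nat) (Y : 'I_n -> Omega -> E) : Prop :=
  forall B : 'I_n -> set E, (forall i, measurable (B i)) ->
    P (\bigcap_i (Y i @^-1` B i)) = (\prod_(i < n) P (Y i @^-1` B i))%E.

(* Only the values [X t] with [0 <= t] are relevant, here and below. *)
Record levy_process d (Omega : measurableType d) (R : realType)
    (P : probability Omega R) (X : R -> Omega -> R * R) : Prop := {
  levy_measurable : forall t, 0 <= t -> measurable_fun [set: Omega] (X t) ;
  levy_start : {ae P, forall w, X 0 w = 0} ;
  levy_indep_increments : forall (n : nat) (s : nat -> R), 0 <= s 0%N ->
    (forall i, (i < n)%N -> s i < s i.+1) ->
    mutually_independent P
      (fun (i : 'I_n) (w : Omega) => X (s i.+1) w - X (s i) w) ;
  levy_stationary_increments : forall s t, 0 <= s -> 0 <= t ->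
    forall B : set (R * R), measurable B ->
      P ((fun w => X (s + t) w - X s w) @^-1` B) = P (X t @^-1` B) ;
  levy_cadlag : {ae P, forall w,
    (forall t, 0 <= t -> X s w @[s --> t^'+] --> X t w) /\
    (forall t, 0 < t -> exists l : R * R, X s w @[s --> t^'-] --> l) }
}.

Definition expi {R : realType} (theta : R) : R[i] := cos theta +i* sin theta.

Definition cexpectation d (Omega : measurableType d) (R : realType)
    (P : probability Omega R) (Z : Omega -> R[i]) : R[i] :=
  fine 'E_P[fun w => complex.Re (Z w)] +i* fine 'E_P[fun w => complex.Im (Z w)].

Definition cauchy_process d (Omega : measurableType d) (R : realType)
    (P : probability Omega R) (X : R -> Omega -> R * R) : Prop :=
  levy_process P X /\
  forall (t : R) (xi : R * R), 0 <= t ->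
    cexpectation P (fun w => expi (dot xi (X t w))) =
    (expR (- (t * enorm xi)))%:C.

Definition Cinfty {R : realType} : set (R * R -> R) :=
  [set f | continuous f /\
    forall e : R, 0 < e -> exists M : R, forall x, M < enorm x -> `|f x| < e].

Definition semigroup d (Omega : measurableType d) (R : realType)
    (P : probability Omega R) (X : R -> Omega -> R * R)
    (t : R) (f : R * R -> R) (x : R * R) : R :=
  fine 'E_P[fun w => f (x + X t w)].

Definition supnorm {R : realType} (h : R * R -> R) : \bar R :=
  ereal_sup (range (fun x => `|h x|%:E)).

(* The graph of the generator [A]: the pairs [(f, g)] with [f] in the domain
   of [A] and [A f = g]. *)
Definition generator_graph d (Omega : measurableType d) (R : realType)
    (P : probability Omega R) (X : R -> Omega -> R * R)
    (f g : R * R -> R) : Prop :=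
  [/\ Cinfty f, Cinfty g &
    supnorm (fun x => t^-1 * (semigroup P X t f x - f x) - g x)
      @[t --> 0^'+] --> 0%E].

Definition generator_domain d (Omega : measurableType d) (R : realType)
    (P : probability Omega R) (X : R -> Omega -> R * R) : set (R * R -> R) :=
  [set f | exists g, generator_graph P X f g].

Definition lipschitz_continuous {R : realType} (f : R * R -> R) : Prop :=
  exists L : R, forall x y, `|f x - f y| <= L * enorm (x - y).

(* Main.v *)
Require Import Defs.
From HB Require Import structures.
From mathcomp Require Import all_boot all_order all_algebra.
From mathcomp Require Import all_classical all_reals all_analysis.
From mathcomp Require Import measurable_realfun ring lra.

(* Let [F(x)] be the integral over the unit circle of [u_1 sin(x . u)] (a
   Bessel function [J_1] up to angular dependence). It vanishes at [0] and at
   infinity, with a rate in both cases, and the characteristic function of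
   [X_t] gives [P_t F(r .) = e^(-rt) F(r .)]. Hence, formally,
   [f = sum_n F(8^n .) / ((n+1) 8^n)] satisfies
   [A f = - sum_n F(8^n .) / (n+1)]. The sums [sum_n |F(8^n x)|] are bounded
   uniformly in [x], by the rates, so the second series converges uniformly
   because its coefficients tend to [0]; this puts [f] in the domain. On the
   other hand [F(u, 0)] is comparable to [u] near [0], so the difference
   quotient of [f] at [0] at scale [8^(-N)] dominates the harmonic sum up to
   [N]. *)

Set Implicit Arguments.
Unset Strict Implicit.
Unset Printing Implicit Defensive.

Import Order.TTheory GRing.Theory Num.Theory.
Import numFieldNormedType.Exports.

Local Open Scope classical_set_scope.
Local Open Scope ring_scope.

(** * Periodic integrals *)

Section Derive.
Variable R : realType.
Implicit Types f g : R -> R.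

Lemma is_deriveV1 f (x df : R) : is_derive x 1 f df -> f x != 0 ->
  is_derive x 1 (fun t => (f t)^-1) (- df / f x ^+ 2).
Proof.
move=> [d1 d2] f0; split; first exact: derivableV.
by rewrite deriveV//= d2; rewrite /GRing.scale/=; field.
Qed.

Lemma is_derive_mul f g (x df dg : R) :
  is_derive x 1 f df -> is_derive x 1 g dg ->
  is_derive x 1 (fun t => f t * g t) (f x * dg + g x * df).
Proof. move=> ? ?. exact: is_deriveM. Qed.

Lemma is_derive_comp1 f g (x df dg : R) :
  is_derive x 1 g dg -> is_derive (g x) 1 f df ->
  is_derive x 1 (fun t => f (g t)) (df * dg).
Proof. move=> ? ?. exact: is_derive1_comp. Qed.

Lemma is_derive_continuous (f df : R -> R) :
  (forall x : R, is_derive x 1 f (df x)) -> continuous f.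
Proof.
move=> h x. apply: differentiable_continuous.
by apply/derivable1_diffP; have [] := h x.
Qed.

End Derive.

Section Circle.
Variable R : realType.
Local Notation twopi := (pi *+ 2 : R).
Local Notation mu := (@lebesgue_measure R).
Local Notation circ := ([set` `[0, twopi]]).

Lemma twopi_gt0 : 0 < twopi.
Proof. by rewrite mulrn_wgt0// pi_gt0. Qed.

Lemma circle_integrable (h : R -> R) : continuous h ->
  mu.-integrable circ (EFin \o h).
Proof.
move=> ch; apply: continuous_compact_integrable; first exact: segment_compact.
by apply: continuous_subspaceT.
Qed.

Lemma circle_measure : fine (mu circ) = twopi.
Proof. by rewrite lebesgue_measure_itv /= lte_fin twopi_gt0/= subr0. Qed.

Lemma circle_int_cst (k : R) : \int[mu]_(t in circ) k = k * twopi.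
Proof. by rewrite Rintegral_cst// circle_measure. Qed.

Lemma circle_int_derive (H h : R -> R) :
  (forall t : R, is_derive t 1 H (h t)) ->
  continuous h -> H twopi = H 0 -> \int[mu]_(t in circ) h t = 0.
Proof.
move=> dH ch e; rewrite /Rintegral (continuous_FTC2 twopi_gt0 (F := H)).
- by rewrite e -EFinB subrr.
- exact: continuous_subspaceT.
- have cH := is_derive_continuous dH. split.
  + by move=> x _; have [] := dH x.
  + exact/cvg_at_right_filter/cH.
  + exact/cvg_at_left_filter/cH.
- by move=> x _; rewrite derive1E; have [] := dH x.
Qed.

End Circle.

(** * The circle average of plane waves and its decay *)

Section Wave.
Variable R : realType.
Local Notation twopi := (pi *+ 2 : R).
Local Notation mu := (@lebesgue_measure R).
Local Notation circ := ([set` `[0, twopi]]).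
Implicit Types (x y : R * R) (t k : R).

Definition dir t : R * R := (cos t, sin t).
(** Minus the derivative of [dir]; together with [dir t] it forms an orthonormal basis of the
    plane. *)
Definition codir t : R * R := (sin t, - cos t).

Lemma dotBl x y z : dot (x - y) z = dot x z - dot y z :> R.
Proof. by rewrite /dot /=; ring. Qed.

Lemma dotC x y : dot x y = dot y x.
Proof. by rewrite /dot /=; ring. Qed.

Lemma dotZl k x y : dot (k *: x) y = k * dot x y.
Proof. by rewrite /dot /= /GRing.scale/=; ring. Qed.

Lemma dot_ge0 x : 0 <= dot x x.
Proof. by rewrite /dot -!expr2 addr_ge0 ?sqr_ge0. Qed.

Lemma enorm_ge0 x : 0 <= enorm x.
Proof. exact: sqrtr_ge0. Qed.

Lemma sqr_enorm x : enorm x ^+ 2 = dot x x.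
Proof. by rewrite /enorm sqr_sqrtr// dot_ge0. Qed.

Lemma enormZ k x : 0 <= k -> enorm (k *: x) = k * enorm x.
Proof.
move=> k0; rewrite /enorm dotZl dotC dotZl mulrA -expr2 sqrtrM ?sqr_ge0//.
by rewrite sqrtr_sqr ger0_norm.
Qed.

Lemma enorm_dir k t : 0 <= k -> enorm (k *: dir t) = k.
Proof.
by move=> k0; rewrite enormZ// /enorm /dot/= -!expr2 cos2Dsin2 sqrtr1 mulr1.
Qed.

Lemma dot_dirD x t : dot x (dir t) ^+ 2 + dot x (codir t) ^+ 2 = enorm x ^+ 2.
Proof.
have := cos2Dsin2 t; rewrite sqr_enorm /dot /=.
set c := cos t; set s := sin t => cs.
transitivity ((x.1 ^+ 2 + x.2 ^+ 2) * (c ^+ 2 + s ^+ 2)); first by ring.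
by rewrite cs; ring.
Qed.

Lemma normr_dot_dir x t : `|dot x (dir t)| <= enorm x.
Proof.
rewrite -(ger0_norm (enorm_ge0 x)) -ler_sqr ?nnegrE// !real_normK ?num_real//.
by rewrite -(dot_dirD x t) lerDl sqr_ge0.
Qed.

Lemma normr_dot_codir x t : `|dot x (codir t)| <= enorm x.
Proof.
rewrite -(ger0_norm (enorm_ge0 x)) -ler_sqr ?nnegrE// !real_normK ?num_real//.
by rewrite -(dot_dirD x t) lerDr sqr_ge0.
Qed.

Lemma is_derive_dot_dir x t :
  is_derive t 1 (fun t => dot x (dir t)) (- dot x (codir t)).
Proof.
have -> : (fun t => dot x (dir t)) = x.1 *: @cos R + x.2 *: @sin R by [].
apply: is_derive_eq; rewrite /dot /= /GRing.scale /=; ring.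
Qed.

Lemma is_derive_dot_codir x t :
  is_derive t 1 (fun t => dot x (codir t)) (dot x (dir t)).
Proof.
have -> : (fun t => dot x (codir t)) = x.1 *: @sin R + x.2 *: (- @cos R) by [].
apply: is_derive_eq; rewrite /dot /= /GRing.scale /=; ring.
Qed.

Lemma continuous_dot_dir x : continuous (fun t => dot x (dir t)).
Proof. exact: is_derive_continuous (is_derive_dot_dir x). Qed.

Lemma continuous_dot_codir x : continuous (fun t => dot x (codir t)).
Proof. exact: is_derive_continuous (is_derive_dot_codir x). Qed.

(** The factor [cos t] makes the integrand even under the antipodal map; the sine alone would
    average to zero. For nonzero [x] the average below is [2 pi J_1(|x|) x_1 / |x|]. *)
Definition wave x t : R := cos t * sin (dot x (dir t)).
Definition wave_int x : R := \int[mu]_(t in circ) wave x t.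

Lemma continuous_wave x : continuous (wave x).
Proof.
move=> t; apply: cvgM; first exact: continuous_cos.
apply: continuous_comp; first exact: continuous_dot_dir.
exact: continuous_sin.
Qed.

Lemma circle_int_norm_le (h : R -> R) k : continuous h ->
  (forall t, `|h t| <= k) -> `|\int[mu]_(t in circ) h t| <= k * twopi.
Proof.
move=> ch hk; have ih := circle_integrable ch.
apply: (le_trans (@le_normr_Rintegral _ _ _ mu _ _ _ ih)) => //.
rewrite -circle_int_cst; apply: le_Rintegral => //.
- by apply: circle_integrable => t; apply: cvg_norm; apply: ch.
- by apply: circle_integrable => t; exact: cvg_cst.
Qed.

Lemma normr_sinB (a b : R) : `|sin a - sin b| <= `|a - b|.
Proof.
wlog ba : a b / b <= a.
  move=> h; have [|/ltW] := leP b a; first exact: h.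
  by move=> /h; rewrite distrC (distrC b).
have [|c _ ->] := @MVT_segment R (@sin R) cos b a ba
    (fun r _ => is_derive_sin r).
  by apply: continuous_subspaceT; exact: continuous_sin.
by rewrite normrM ler_piMl// cos_max.
Qed.

Lemma normr_sin_le (a : R) : `|sin a| <= `|a|.
Proof. by have := normr_sinB a 0; rewrite sin0 !subr0. Qed.

Lemma wave_lip x y t : `|wave x t - wave y t| <= enorm (x - y).
Proof.
rewrite /wave -mulrBr normrM.
apply: le_trans (ler_piMl (normr_ge0 _) (cos_max t)) _.
apply: le_trans (normr_sinB _ _) _.
by rewrite -dotBl normr_dot_dir.
Qed.

Lemma wave_int_lip x y : `|wave_int x - wave_int y| <= twopi * enorm (x - y).
Proof.
have iw z := circle_integrable (continuous_wave (x := z)).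
rewrite /wave_int -RintegralB//.
rewrite mulrC; apply: circle_int_norm_le; last by move=> t; exact: wave_lip.
by move=> t; apply: cvgB; exact: continuous_wave.
Qed.

Lemma wave_int0 : wave_int 0 = 0.
Proof.
rewrite /wave_int -[RHS](mul0r twopi) -circle_int_cst.
apply: eq_Rintegral => t _.
by rewrite /wave /dot/= !mul0r addr0 sin0 mulr0.
Qed.

Lemma wave_int_le_norm x : `|wave_int x| <= twopi * enorm x.
Proof. by have := wave_int_lip x 0; rewrite wave_int0 !subr0. Qed.

Lemma wave_int_bounded x : `|wave_int x| <= twopi.
Proof.
rewrite -[leRHS]mul1r; apply: circle_int_norm_le; first exact: continuous_wave.
by move=> t; rewrite /wave normrM mulr_ile1 // ?cos_max ?sin_max.
Qed.

(** The mean value theorem gives [sin a = a cos c] with [0 <= c <= 1], and [cos c = 1 - 2 sin(c/2)^2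
    >= 1 - c^2 / 2 >= 1/2]. *)
Lemma sin_ge_half (a : R) : 0 <= a <= 1 -> a / 2 <= sin a.
Proof.
move=> /andP[a0 a1].
have [|c] := @MVT_segment R (@sin R) cos 0 a a0
    (fun r _ => is_derive_sin r).
  by apply: continuous_subspaceT; exact: continuous_sin.
rewrite in_itv/= sin0 !subr0 => /andP[c0 ca] ->.
rewrite mulrC ler_wpM2r//.
have : `|sin (c / 2)| ^+ 2 <= (c / 2) ^+ 2.
  have := normr_sin_le (c / 2).
  rewrite (ger0_norm (_ : 0 <= c / 2)) ?divr_ge0//.
  by move=> h; rewrite ler_sqr ?nnegrE ?divr_ge0.
rewrite real_normK ?num_real// sin2cos2.
have -> : cos c = cos (c / 2) ^+ 2 *+ 2 - 1.
  by rewrite -cos_mulr2n; congr cos; field.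
nra.
Qed.

(** Both sides are even in [z]; for [z >= 0], factor out [z] and apply [sin_ge_half] to [z * u]. *)
Lemma sin_mul_ge (u z : R) : 0 <= u <= 1 -> `|z| <= 1 ->
  u / 2 * z ^+ 2 <= z * sin (z * u).
Proof.
wlog z0 : z / 0 <= z.
  move=> h u01 z1; have [|/ltW z0] := leP 0 z; first by move=> /h; exact.
  have := h (- z); rewrite oppr_ge0 normrN z0 => /(_ erefl u01 z1).
  by rewrite sqrrN !mulNr sinN mulrN opprK.
move=> /andP[u0 u1]; rewrite (ger0_norm z0) => z1.
have -> : u / 2 * z ^+ 2 = z * ((z * u) / 2) by field.
rewrite ler_wpM2l// sin_ge_half// mulr_ge0//=.
by rewrite mulr_ile1.
Qed.

Lemma circle_int_cos2 : \int[mu]_(t in circ) (cos t ^+ 2) = pi.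
Proof.
have c2 : continuous (fun t : R => cos t ^+ 2).
  by move=> t; rewrite /=; apply: cvgM; exact: continuous_cos.
have h0 : \int[mu]_(t in circ) (2 * cos t ^+ 2 - 1) = 0.
  apply: (@circle_int_derive _ (fun t => sin t * cos t)).
  - move=> t.
    apply: (is_derive_eq (is_derive_mul (is_derive_sin t) (is_derive_cos t))).
    by have := cos2Dsin2 t; lra.
  - move=> t; apply: cvgB; last exact: cvg_cst.
    by apply: cvgM; [exact: cvg_cst|exact: c2].
  - by rewrite sin2pi sin0 !mul0r.
move: h0; rewrite RintegralB//=; last 2 first.
- by apply: circle_integrable => t; apply: cvgM; [exact: cvg_cst|exact: c2].
- by apply: circle_integrable => t; exact: cvg_cst.
rewrite circle_int_cst RintegralZl//; last exact: circle_integrable.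
by rewrite mulr2n; lra.
Qed.

(** Integrates [sin_mul_ge] at [z = cos t]. This linear growth along the first axis is what later
    defeats every Lipschitz constant. *)
Lemma wave_int_ge (u : R) : 0 <= u <= 1 -> u * pi / 2 <= wave_int (u, 0).
Proof.
move=> u01.
have c2 : continuous (fun t : R => cos t ^+ 2).
  by move=> t; rewrite /=; apply: cvgM; exact: continuous_cos.
have -> : u * pi / 2 = (u / 2) * pi by field.
rewrite -circle_int_cos2 -RintegralZl//; last exact: circle_integrable.
apply: le_Rintegral => //.
- by apply: circle_integrable => t; apply: cvgM; [exact: cvg_cst|exact: c2].
- by apply: circle_integrable; exact: continuous_wave.
move=> t _; rewrite /wave /dot/= mul0r addr0 (mulrC u (cos t)).
by apply: sin_mul_ge => //; exact: cos_max.
Qed.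

End Wave.

(** * Decay at infinity, by integration by parts *)

Section Decay.
Variable R : realType.
Local Notation twopi := (pi *+ 2 : R).
Local Notation mu := (@lebesgue_measure R).
Local Notation circ := ([set` `[0, twopi]]).

(** Derivatives of periodic functions integrate to zero, so one may be subtracted from the integrand
    and a multiple of another added to its pointwise bound. *)
Lemma circle_int_le_mod_derive (h H1 h1 H2 h2 : R -> R) (M m : R) :
  continuous h ->
  (forall t : R, is_derive t 1 H1 (h1 t)) -> continuous h1 -> H1 twopi = H1 0 ->
  (forall t : R, is_derive t 1 H2 (h2 t)) -> continuous h2 -> H2 twopi = H2 0 ->
  (forall t, `|h t - h1 t| <= M + m * h2 t) ->
  `|\int[mu]_(t in circ) h t| <= M * twopi.
Proof.
move=> ch dH1 ch1 e1 dH2 ch2 e2 hM.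
have i1 := circle_integrable ch1.
have i2 := circle_integrable ch2.
have ih := circle_integrable ch.
have chB : continuous (fun t => h t - h1 t).
  by move=> t; apply: cvgB; [exact: ch|exact: ch1].
have ihB := circle_integrable chB.
have -> : \int[mu]_(t in circ) h t = \int[mu]_(t in circ) (h t - h1 t).
  by rewrite RintegralB// (circle_int_derive dH1)// subr0.
apply: (le_trans (@le_normr_Rintegral _ _ _ mu _ _ _ ihB)) => //.
have cm2 : continuous (fun t => m * h2 t).
  by move=> t; apply: cvgM; [exact: cvg_cst|exact: ch2].
have cM : continuous (fun t => M + m * h2 t).
  by move=> t; apply: cvgD; [exact: cvg_cst|exact: cm2].
apply: (@le_trans _ _ (\int[mu]_(t in circ) (M + m * h2 t))).
  apply: le_Rintegral => //; last exact: circle_integrable.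
  by apply: circle_integrable => t; apply: cvg_norm; exact: chB.
rewrite RintegralD//; last 2 first.
- by apply: circle_integrable => t; exact: cvg_cst.
- exact: circle_integrable.
by rewrite circle_int_cst RintegralZl// (circle_int_derive dH2)// mulr0 addr0.
Qed.

Lemma normr_atan_le2 (a : R) : `|atan a| <= 2.
Proof.
have := atan_ltpi2 a; have := atan_gtNpi2 a; have := @pihalf_lt2 R.
by rewrite ler_norml; set b := atan a; move=> h1 h2 h3; apply/andP; split; lra.
Qed.

Variable x : R * R.
Variable s : R.
Hypothesis s0 : 0 < s.

Local Notation p t := (dot x (dir t)).
Local Notation q t := (dot x (codir t)).
(** A regularised [1 / q^2]. The phase [p] is stationary where [q] vanishes, and [s] is the scale
    below which [q] counts as small. *)
Local Notation w t := (q t ^+ 2 + s ^+ 2)^-1.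

Let den_gt0 t : 0 < q t ^+ 2 + s ^+ 2.
Proof. by rewrite ltr_wpDl ?sqr_ge0// exprn_gt0. Qed.

Let is_derive_w (t : R) :
  is_derive t 1 (fun t => w t) (- (2 * q t * p t) * w t ^+ 2).
Proof.
have d : is_derive t 1 (fun t => q t * q t + s ^+ 2) (2 * q t * p t).
  have h := is_derive_mul (is_derive_dot_codir x t) (is_derive_dot_codir x t).
  by apply: (is_derive_eq (is_deriveD h (is_derive_cst (s ^+ 2) t 1))); ring.
have n0 : q t * q t + s ^+ 2 != 0 by rewrite -expr2 gt_eqF.
have -> : (fun t => w t) = fun t => (q t * q t + s ^+ 2)^-1.
  by apply/funext => u; rewrite expr2.
apply: (is_derive_eq (is_deriveV1 d n0)).
by rewrite -expr2; field; rewrite gt_eqF.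
Qed.

(* With [p' = - q] and [q' = p], split [1 = q^2 w + s^2 w]. The part of [wave]
   carrying [q^2 w] is integrated by parts against [(cos p)' = q sin p] (the
   primitive [decay_prim1]); the part carrying [s^2 w] is only large where [q]
   is small, and [s^2 w] is there controlled by the derivative of
   [decay_prim2]. *)
Definition decay_prim1 t := cos t * q t * w t * cos (p t).
Definition decay_der1 t := cos t * sin (p t) * q t ^+ 2 * w t +
  cos (p t) * (- sin t * q t * w t +
    cos t * p t * w t * (1 - 2 * q t ^+ 2 * w t)).

Lemma is_derive_decay1 (t : R) : is_derive t 1 decay_prim1 (decay_der1 t).
Proof.
have d1 := is_derive_mul (is_derive_cos t) (is_derive_dot_codir x t).
have d2 := is_derive_mul d1 (is_derive_w t).
have d3 := is_derive_comp1 (is_derive_dot_dir x t) (is_derive_cos (p t)).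
by apply: (is_derive_eq (is_derive_mul d2 d3)); rewrite /decay_der1; ring.
Qed.

Definition decay_prim2 t := p t * atan (q t * s^-1).
Definition decay_der2 t := - q t * atan (q t * s^-1) + p t ^+ 2 * s * w t.

Lemma is_derive_decay2 (t : R) : is_derive t 1 decay_prim2 (decay_der2 t).
Proof.
have d1 := is_derive_mul (is_derive_dot_codir x t) (is_derive_cst (s^-1) t 1).
have d2 := is_derive_comp1 d1 (is_derive1_atan _).
apply: (is_derive_eq (is_derive_mul (is_derive_dot_dir x t) d2)).
rewrite /decay_der2 /cst /=; field.
by rewrite !gt_eqF.
Qed.

Let continuous_w : continuous (fun t => w t).
Proof. exact: is_derive_continuous is_derive_w. Qed.

Let continuous_atan_q : continuous (fun t => atan (q t * s^-1)).
Proof.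
move=> t; apply: (@continuous_comp _ _ _ (fun t => q t * s^-1)).
  by apply: cvgM; [exact: continuous_dot_codir|exact: cvg_cst].
exact: continuous_atan.
Qed.

Let continuous_cosp : continuous (fun t => cos (p t)).
Proof.
move=> t; apply: (@continuous_comp _ _ _ (fun t => p t)).
  exact: continuous_dot_dir.
exact: continuous_cos.
Qed.

Lemma continuous_decay1 : continuous decay_der1.
Proof.
have cp := @continuous_dot_dir R x; have cq := @continuous_dot_codir R x.
have cc := @continuous_cos R; have cs := @continuous_sin R.
move=> t; apply: cvgD.
  apply: cvgM; last exact: continuous_w.
  apply: cvgM; last by apply: cvgM; exact: cq.
  exact: continuous_wave.
apply: cvgM; first exact: continuous_cosp.
apply: cvgD.
  apply: cvgM; last exact: continuous_w.
  by apply: cvgM; [apply: cvgN; exact: cs|exact: cq].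
apply: cvgM.
  by apply: cvgM; last exact: continuous_w; apply: cvgM; [exact: cc|exact: cp].
apply: cvgB; first exact: cvg_cst.
apply: cvgM; last exact: continuous_w.
by apply: cvgM; [exact: cvg_cst|apply: cvgM; exact: cq].
Qed.

Lemma continuous_decay2 : continuous decay_der2.
Proof.
have cp := @continuous_dot_dir R x; have cq := @continuous_dot_codir R x.
move=> t; apply: cvgD.
  by apply: cvgM; [apply: cvgN; exact: cq|exact: continuous_atan_q].
apply: cvgM; last exact: continuous_w.
by apply: cvgM; [apply: cvgM; exact: cp|exact: cvg_cst].
Qed.

(** The two terms where the derivative falls on the coefficient [cos t * q * w] are each at most
    [|x| / s^2], because [w <= s^-2] and [0 <= q^2 w <= 1]. What remains is at most [s^2 w], bounded
    in [main]. *)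
Lemma decay_pointwise t : 0 < enorm x ->
  `|wave x t - decay_der1 t| <=
  (2 * enorm x / s ^+ 2 + 2 * s / enorm x + s ^+ 2 / enorm x ^+ 2) +
  s / enorm x ^+ 2 * decay_der2 t.
Proof.
set r := enorm x => r0.
have w0 : 0 < w t by rewrite invr_gt0.
have wE : (q t ^+ 2 + s ^+ 2) * w t = 1 by rewrite mulfV// gt_eqF.
have pq := dot_dirD x t.
have pr := normr_dot_dir x t; have qr := normr_dot_codir x t.
have at2 := normr_atan_le2 (q t * s^-1).
have ws : w t <= (s ^+ 2)^-1.
  by rewrite lef_pV2 ?posrE ?exprn_gt0// lerDr sqr_ge0.
have cs := cos_max t; have ss := sin_max t; have ccp := cos_max (p t).
have scp := sin_max (p t).
rewrite /wave /decay_der1 /decay_der2 -/r in pq pr qr *.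
move: pq pr qr at2 ws w0 wE cs ss ccp scp.
move: (p t) (q t) (w t) (atan _) (cos t) (sin t) => P Q W A c d.
move=> pq pr qr at2 ws w0 wE cs ss ccp scp.
have -> : c * sin P - (c * sin P * Q ^+ 2 * W +
    cos P * (- d * Q * W + c * P * W * (1 - 2 * Q ^+ 2 * W))) =
    c * sin P * (s ^+ 2 * W) +
    (cos P * (d * (Q * W)) - cos P * (c * ((1 - 2 * Q ^+ 2 * W) * (P * W)))).
  have -> : s ^+ 2 * W = 1 - Q ^+ 2 * W by rewrite -wE; ring.
  ring.
have small (a b e : R) : `|a| <= 1 -> `|b| <= e -> `|a * b| <= e.
  move=> a1 be; rewrite normrM; apply: le_trans be.
  by rewrite ler_piMl.
(* Write [s^2 W] as [s^2 / r^2 * (P^2 + Q^2) W]. The [P^2] part occurs in [decay_der2], the [Q^2]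
   part is at most [s^2 / r^2], and compensating the arctangent term costs [2 s / r] since
   [|Q A| <= 2 r]. *)
have main : s ^+ 2 * W <= 2 * s / r + s ^+ 2 / r ^+ 2 +
    s / r ^+ 2 * (- Q * A + P ^+ 2 * s * W).
  have -> : s ^+ 2 * W = s ^+ 2 / r ^+ 2 * ((P ^+ 2 + Q ^+ 2) * W).
    by rewrite pq; field; rewrite gt_eqF.
  have QA : Q * A <= r * 2.
    by apply: le_trans (ler_norm _) _; rewrite normrM ler_pM.
  have QW : Q ^+ 2 * W <= 1 by rewrite -wE mulrDl lerDl mulr_ge0 ?sqr_ge0 ?ltW.
  have -> : 2 * s / r = s / r ^+ 2 * (r * 2) by field; rewrite gt_eqF.
  rewrite -subr_ge0.
  set k := r ^+ 2.
  have -> : s / k * (r * 2) + s ^+ 2 / k + s / k * (- Q * A + P ^+ 2 * s * W) -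
    s ^+ 2 / k * ((P ^+ 2 + Q ^+ 2) * W) =
    s / k * (r * 2 - Q * A) + s ^+ 2 / k * (1 - Q ^+ 2 * W) by ring.
  have k0 : 0 < k by rewrite exprn_gt0.
  by rewrite addr_ge0// mulr_ge0 ?subr_ge0// divr_ge0 ?sqr_ge0 ?ltW.
have prod (a : R) : `|a| <= r -> `|a * W| <= r / s ^+ 2.
  by move=> ar; rewrite normrM (ger0_norm (ltW w0)) ler_pM// ltW.
have first_term : `|c * sin P * (s ^+ 2 * W)| <= s ^+ 2 * W.
  apply: (small); first by rewrite normrM mulr_ile1.
  by rewrite ger0_norm// mulr_ge0 ?sqr_ge0 ?ltW.
have second : `|cos P * (d * (Q * W))| <= r / s ^+ 2.
  by apply: (small) => //; apply: (small) => //; exact: prod.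
have third : `|cos P * (c * ((1 - 2 * Q ^+ 2 * W) * (P * W)))| <= r / s ^+ 2.
  apply: (small) => //; apply: (small) => //; apply: (small); last exact: prod.
  have : 0 <= Q ^+ 2 * W by rewrite mulr_ge0 ?sqr_ge0 ?ltW.
  have : Q ^+ 2 * W <= 1 by rewrite -wE mulrDl lerDl mulr_ge0 ?sqr_ge0 ?ltW.
  by rewrite ler_norml => ? ?; apply/andP; split; lra.
apply: le_trans (ler_normD _ _) _.
apply: (@le_trans _ _ (s ^+ 2 * W + (r / s ^+ 2 + r / s ^+ 2))).
  by apply: lerD => //; apply: le_trans (ler_normB _ _) _; exact: lerD.
by move: main; rewrite -[2 * r / _]mulrA; set z := r / _ => main; lra.
Qed.

Lemma wave_int_decay_aux : 0 < enorm x -> `|wave_int x| <=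
  (2 * enorm x / s ^+ 2 + 2 * s / enorm x + s ^+ 2 / enorm x ^+ 2) * twopi.
Proof.
move=> r0; apply: (circle_int_le_mod_derive _ is_derive_decay1 _ _
  is_derive_decay2) => //.
- exact: continuous_wave.
- exact: continuous_decay1.
- by rewrite /decay_prim1 /dot /= cos2pi sin2pi cos0 sin0.
- exact: continuous_decay2.
- by rewrite /decay_prim2 /dot /= cos2pi sin2pi cos0 sin0.
- by move=> t; exact: decay_pointwise.
Qed.

End Decay.

(** The cutoff is [s = e |x|], which turns the bound into [2 / (e^2 |x|) + 2 e + e^2 <= 5 e]. Taking
    [e = |x|^(-1/3)] gives the rate; stating it through [e] avoids cube roots. *)
Lemma wave_int_decay (R : realType) (x : R * R) (e : R) : 0 < e <= 1 ->
  1 <= enorm x * e ^+ 3 -> `|wave_int x| <= (5 * (pi *+ 2)) * e.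
Proof.
move=> /andP[e0 e1] h.
have r0 : 0 < enorm x.
  rewrite lt_neqAle enorm_ge0 andbT; apply/eqP => r0.
  by move: h; rewrite -r0 mul0r ler10.
have s0 : 0 < e * enorm x by rewrite mulr_gt0.
apply: le_trans (wave_int_decay_aux s0 r0) _.
rewrite [leRHS]mulrAC ler_pM2r ?twopi_gt0//.
set r := enorm x in h r0 s0 *.
have -> : 2 * r / (e * r) ^+ 2 + 2 * (e * r) / r + (e * r) ^+ 2 / r ^+ 2 =
  2 / (e ^+ 2 * r) + 2 * e + e ^+ 2.
  by field; rewrite !gt_eqF.
have : (e ^+ 2 * r)^-1 <= e.
  rewrite -[leRHS]mul1r -ler_pdivrMr// -invfM invf_le1 ?mulr_gt0 ?exprn_gt0//.
  by apply: le_trans h _; rewrite le_eqVlt; apply/orP; left; apply/eqP; ring.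
have : e ^+ 2 <= e by rewrite expr2 ler_piMl// ltW.
by lra.
Qed.

(** * Series of dilated waves *)

Section Series.
Variable R : realType.
Local Notation C := (5 * (pi *+ 2) : R).
Implicit Types (x y : R * R) (b : nat -> R).

Lemma wave_bound_gt0 : 0 < C.
Proof. by rewrite mulr_gt0// twopi_gt0. Qed.

Definition wave_int8 n x : R := wave_int (8 ^+ n *: x).

(** Since [8 = 2^3], the quantity [|x| e^3] is unchanged when [x] is multiplied by [8 ^ n] and [e]
    by [2 ^ -n]. This is the reason for the base 8. *)
Lemma wave_int8_decay n x (e : R) : 0 < e <= 1 -> 1 <= enorm x * e ^+ 3 ->
  `|wave_int8 n x| <= C * e * 2^-1 ^+ n.
Proof.
move=> /andP[e0 e1] h; rewrite -mulrA; apply: wave_int_decay.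
  rewrite mulr_gt0 ?exprn_gt0//= mulr_ile1 ?exprn_ge0 ?(ltW e0)//.
  by rewrite exprn_ile1 ?invf_le1 ?ler1n.
apply: le_trans h _; rewrite enormZ ?exprn_ge0//.
rewrite exprMn -!exprM (mulnC n) exprM.
have -> : 8 ^+ n * enorm x * (e ^+ 3 * (2^-1 ^+ 3) ^+ n) =
  enorm x * e ^+ 3 * (8 * 2^-1 ^+ 3) ^+ n.
  by rewrite (exprMn n 8); set u := 8 ^+ n; set v := (_ ^+ 3) ^+ n; ring.
have -> : 8 * 2^-1 ^+ 3 = 1 :> R by field.
by rewrite expr1n mulr1.
Qed.

Lemma wave_int8_sum_decay N x (e : R) : 0 < e <= 1 -> 1 <= enorm x * e ^+ 3 ->
  \sum_(n < N) `|wave_int8 n x| <= 2 * C * e.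
Proof.
move=> e01 h; have e0 : 0 < e by case/andP: e01.
apply: (@le_trans _ _ (\sum_(n < N) C * e * 2^-1 ^+ n)).
  by apply: ler_sum => n _; exact: wave_int8_decay.
have -> : \sum_(n < N) C * e * 2^-1 ^+ n = 2 * C * e * (1 - 2^-1 ^+ N).
  elim: N => [|N IH]; first by rewrite big_ord0 expr0 subrr mulr0.
  by rewrite big_ord_recr/= IH exprS; field.
have K0 : 0 <= 2 * C * e by apply: ltW; rewrite !mulr_gt0// twopi_gt0.
by rewrite ler_piMr// gerBl exprn_ge0.
Qed.

(** Dilates of small norm are bounded linearly by [wave_int_le_norm] and those of large norm by the
    decay, so the sum is geometric on both sides of norm 1. *)
Lemma wave_int8_sum_le N x : \sum_(n < N) `|wave_int8 n x| <= 4 * C.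
Proof.
have C0 := wave_bound_gt0.
have far y M : 1 <= enorm y -> \sum_(n < M) `|wave_int8 n y| <= 2 * C.
  move=> y1; rewrite -[leRHS]mulr1; apply: wave_int8_sum_decay.
    by rewrite ltr01 lexx.
  by rewrite expr1n mulr1.
(* The term [- C |y| / 7] absorbs the new summand, at most [C |y|], when the
   induction passes from [8 y] to [y]. *)
have near8 : forall M y, enorm y <= 8 ->
    \sum_(n < M) `|wave_int8 n y| <= 4 * C - C * enorm y / 7.
  elim=> [|M IH] y y8.
    rewrite big_ord0; have : C * enorm y <= C * 8 by rewrite ler_pM2l.
    by set u := C * enorm y; move: C0; set v := C => v0 uv; lra.
  (* For [1 <= |y| <= 8] the bound from [far] is enough, as [4 C - 8 C / 7 >= 2 C]. For [|y| < 1]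
     the point [8 y] is still in the range of the induction hypothesis. *)
  have [y1|/ltW y1] := leP 1 (enorm y).
    apply: le_trans (far _ _ y1) _.
    have : C * enorm y <= C * 8 by rewrite ler_pM2l.
    by set u := C * enorm y; move: C0; set v := C => v0 uv; lra.
  rewrite big_ord_recl.
  have -> : \sum_(i < M) `|wave_int8 (lift ord0 i) y| =
      \sum_(i < M) `|wave_int8 i (8 *: y)|.
    by apply: eq_bigr => i _; rewrite /wave_int8 lift0 exprSr scalerA.
  have := IH (8 *: y); rewrite enormZ// => /(_ _).
  have -> /= : 8 * enorm y <= 8 by rewrite ler_piMr.
  move=> /(_ isT) IHy.
  have h : `|wave_int8 0 y| <= C * enorm y.
    rewrite /wave_int8 expr0 scale1r; apply: le_trans (wave_int_le_norm _) _.
    rewrite ler_wpM2r ?enorm_ge0// ler_peMl ?ltW ?twopi_gt0//.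
    by rewrite ltr1n.
  move: IHy h; rewrite (mulrCA C 8); set u := C * enorm y.
  set v := `|_|; set S := \sum_(_ < _) _; lra.
have [y1|/ltW y1] := leP 1 (enorm x).
  by apply: le_trans (far _ _ y1) _; rewrite ler_pM2r// ler_nat.
apply: le_trans (near8 _ _ _) _; first by rewrite (le_trans y1)// ler1n.
by rewrite gerBl divr_ge0// mulr_ge0 ?enorm_ge0// ltW.
Qed.

(** For bounded [b] this is a genuine limit, by [is_cvg_wave_series]. *)
Definition wave_series b x : R := limn (series (fun n => b n * wave_int8 n x)).

Lemma is_cvg_wave_series b x (M : R) : (forall n, `|b n| <= M) ->
  cvgn (series (fun n => b n * wave_int8 n x)).
Proof.
move=> bM; have M0 : 0 <= M by apply: le_trans (bM 0%N).
apply: normed_cvg; apply: nondecreasing_is_cvgn.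
  apply/nondecreasing_seqP => n.
  by rewrite -subr_ge0 [X in 0 <= X]seriesSB normr_ge0.
exists (M * (4 * C)) => _ [n _ <-]; rewrite /= seriesEord.
apply: le_trans (ler_wpM2l M0 (wave_int8_sum_le n x)).
rewrite mulr_sumr; apply: ler_sum => i _.
by rewrite normrM ler_wpM2r.
Qed.

(** The bound [k] is left free so as to take either the uniform value [4 C] or, far from the origin,
    a small one. *)
Lemma wave_series_approx b x N (M e k : R) : (forall n, `|b n| <= M) ->
  (forall n, (N <= n)%N -> `|b n| <= e) ->
  (forall m, \sum_(n < m) `|wave_int8 n x| <= k) ->
  `|wave_series b x - \sum_(n < N) b n * wave_int8 n x| <= e * k.
Proof.
move=> bM be hk; have e0 : 0 <= e by apply: le_trans (be N (leqnn _)).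
have cv := is_cvg_wave_series (x := x) bM.
have : (fun m => `|series (fun n => b n * wave_int8 n x) m -
    \sum_(n < N) b n * wave_int8 n x|) @ \oo -->
    `|wave_series b x - \sum_(n < N) b n * wave_int8 n x|.
  by apply: cvg_norm; apply: cvgB => //; exact: cvg_cst.
move=> cvn; rewrite -(cvg_lim _ cvn)//; apply: limr_le; first exact: cvgP cvn.
exists N => // m /= Nm; rewrite seriesEord /= -(subnKC Nm) big_split_ord/= addrC addrK.
apply: le_trans (ler_norm_sum _ _ _) _.
apply: le_trans (ler_wpM2l e0 (hk m)).
rewrite -[in leRHS](subnKC Nm) big_split_ord/= mulrDr.
rewrite ler_wpDl ?mulr_ge0 ?sumr_ge0// mulr_sumr.
by apply: ler_sum => i _; rewrite normrM ler_wpM2r// be// leq_addr.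
Qed.

Lemma wave_series_bound b x (e k : R) : (forall n, `|b n| <= e) ->
  (forall m, \sum_(n < m) `|wave_int8 n x| <= k) -> `|wave_series b x| <= e * k.
Proof.
move=> be hk; have := @wave_series_approx b x 0%N e e k be (fun n _ => be n) hk.
by rewrite big_ord0 subr0.
Qed.

(** The combination is shaped for a difference quotient minus its limit, with [k = t^-1]. *)
Lemma wave_series_lin b b' b'' x (k M : R) : (forall n, `|b n| <= M) ->
  (forall n, `|b' n| <= M) -> (forall n, `|b'' n| <= M) ->
  wave_series (fun n => k * (b n - b' n) - b'' n) x =
  k * (wave_series b x - wave_series b' x) - wave_series b'' x.
Proof.
move=> /(is_cvg_wave_series (x := x)) c1 /(is_cvg_wave_series (x := x)) c2.
move=> /(is_cvg_wave_series (x := x)) c3.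
apply/cvg_lim => //.
have -> : series (fun n => (k * (b n - b' n) - b'' n) * wave_int8 n x) =
  (fun m => k * (series (fun n => b n * wave_int8 n x) m -
    series (fun n => b' n * wave_int8 n x) m) -
    series (fun n => b'' n * wave_int8 n x) m).
  apply/funext => m; rewrite /series/= -sumrB mulr_sumr -sumrB.
  by apply: eq_bigr => n _; ring.
apply: cvgB => //; apply: cvgM; first exact: cvg_cst.
exact: cvgB.
Qed.

Lemma continuous_wave_int : continuous (@wave_int R).
Proof.
move=> x; apply/cvgrPdist_le => e e0.
have K0 : 0 < (2 * (pi *+ 2)) :> R by rewrite mulr_gt0// twopi_gt0.
near=> y.
apply: le_trans (wave_int_lip _ _) _.
have h : `|x - y| <= e / (2 * (pi *+ 2)).
  near: y; apply: cvgr_dist_le; first exact: cvg_id.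
  by rewrite divr_gt0.
(* The topology of the plane is given here by the max norm, whereas the Lipschitz bound uses the
   Euclidean one. *)
have : enorm (x - y) <= 2 * `|x - y|.
  rewrite -(ger0_norm (enorm_ge0 _)) -[leRHS]ger0_norm ?mulr_ge0//.
  rewrite -ler_sqr ?nnegrE// !real_normK ?num_real// sqr_enorm.
  have : `|(x - y).1| <= `|x - y| by rewrite prod_normE le_max lexx.
  have : `|(x - y).2| <= `|x - y| by rewrite prod_normE le_max lexx orbT.
  rewrite /dot; set a := (x - y).1; set b := (x - y).2; set c := `|x - y|.
  rewrite !ler_norml => /andP[h1 h2] /andP[h3 h4]; nra.
move=> h2; rewrite -ler_pdivlMl ?twopi_gt0//; apply: le_trans h2 _.
rewrite -ler_pdivlMl//; apply: le_trans h _.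
by rewrite invfM (mulrC e) -mulrA.
Unshelve. all: by end_near. Qed.

Lemma continuous_wave_int8 n : continuous (wave_int8 n).
Proof.
move=> x; apply: (@continuous_comp _ _ _ (fun x => 8 ^+ n *: x)).
  exact: scaler_continuous.
exact: continuous_wave_int.
Qed.

Lemma cvg0_tail b (e : R) : b @ \oo --> 0 -> 0 < e ->
  exists N, forall n, (N <= n)%N -> `|b n| <= e.
Proof.
move=> /cvgr0_norm_le b0 e0; have [N _ h] := b0 _ e0.
by exists N => n Nn; exact: h.
Qed.

(** Since [b] tends to 0, the partial sums converge uniformly, whence continuity. Vanishing at
    infinity comes from [wave_int8_sum_decay] and the boundedness of [b]. *)
Lemma wave_series_Cinfty b (M : R) : (forall n, `|b n| <= M) -> b @ \oo --> 0 ->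
  Cinfty (wave_series b).
Proof.
move=> bM b0; have C0 := wave_bound_gt0; split.
  move=> x; apply/cvgrPdist_le => e e0.
  have e30 : 0 < e / 3 / (4 * C) by rewrite !divr_gt0// mulr_gt0.
  have [N hN] := cvg0_tail b0 e30.
  have ap y := wave_series_approx bM hN (wave_int8_sum_le ^~ y).
  have e3E : e / 3 / (4 * C) * (4 * C) = e / 3.
    by rewrite divfK// gt_eqF// mulr_gt0.
  near=> y.
  have h : `|\sum_(n < N) b n * wave_int8 n x -
      \sum_(n < N) b n * wave_int8 n y| <= e / 3.
    near: y; apply: cvgr_dist_le; last by rewrite divr_gt0.
    apply: cvg_big => [|n _]; first exact: add_continuous.
    apply: cvgM; first exact: cvg_cst.
    exact: continuous_wave_int8.
  have := ap x; have := ap y; rewrite e3E.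
  move: h; rewrite !ler_norml => /andP[? ?] /andP[? ?] /andP[? ?].
  by apply/andP; split; lra.
move=> e e0; have M0 : 0 <= M by apply: le_trans (bM 0%N).
(* With this [d] the bound [M * (2 C d)] is at most [e / 2]; [M + 1] avoids dividing by zero. The
   radius [d^-3] is what the condition [1 <= |x| d^3] requires. *)
pose d := Num.min 1 (e / 2 / (M + 1) / (2 * C)).
have M1 : 0 < M + 1 by rewrite ltr_wpDl.
have C2 : 0 < 2 * C by rewrite mulr_gt0.
have d0 : 0 < d by rewrite lt_min ltr01/= !divr_gt0.
exists (d ^+ 3)^-1 => x dx.
apply: (@le_lt_trans _ _ (M * (2 * C * d))).
  apply: wave_series_bound => // m; apply: wave_int8_sum_decay.
    by rewrite d0 ge_min lexx.
  by rewrite -ler_pdivrMr ?exprn_gt0// mul1r ltW.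
have : d <= e / 2 / (M + 1) / (2 * C) by rewrite ge_min lexx orbT.
rewrite ler_pdivlMr// ler_pdivlMr// => h.
by move: h M0 (mulr_gt0 d0 C2); set u := d * (2 * C) => h M0 u0;
  rewrite (mulrC _ d) -/u; nra.
Unshelve. all: by end_near. Qed.

End Series.

(** * The action of the semigroup *)

Section Fubini_wave.
Context d (T : measurableType d) (R : realType) (P : probability T R).
Variable Y : T -> R * R.
Hypothesis mY : measurable_fun [set: T] Y.
Local Notation twopi := (pi *+ 2 : R).
Local Notation mu := (@lebesgue_measure R).
Local Notation circ := ([set` `[0, twopi]]).

Lemma probability_bounded_integrable (h : T -> R) (M : R) :
  measurable_fun [set: T] h -> (forall w, `|h w| <= M) ->
  P.-integrable [set: T] (EFin \o h).
Proof.
move=> mh hM; apply: measurable_bounded_integrable => //.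
  by apply: (@le_lt_trans _ _ 1%E); [exact: probability_le1|exact: ltry].
exists M; split; first exact: num_real.
by move=> k Mk w _ /=; apply: le_trans (hM w) (ltW Mk).
Qed.

(** The indicator extends the integrand by zero, so that Fubini applies on the whole product. *)
Let f (z : T * measurableTypeR R) : \bar R :=
  (wave (Y z.1) z.2 * \1_circ z.2)%:E.

Let mf : measurable_fun setT f.
Proof.
have m1 : measurable_fun setT (fun z : T * measurableTypeR R => Y z.1).
  exact: (measurableT_comp mY).
have mc (h : R -> R) : continuous h ->
    measurable_fun setT (fun z : T * measurableTypeR R => h z.2).
  move=> ch.
  apply: (@measurableT_comp _ _ _ _ _ _ (h : measurableTypeR R -> R)).
    exact: continuous_measurable_fun.
  exact: measurable_snd.
have cc := @continuous_cos R; have cs := @continuous_sin R.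
apply/measurable_EFinP; apply: measurable_funM; last first.
  apply: (@measurableT_comp _ _ _ _ _ _ (\1_circ : measurableTypeR R -> R)).
    by apply: measurable_indic; exact: measurable_itv.
  exact: measurable_snd.
apply: measurable_funM; first exact: mc.
apply: measurableT_comp; first exact: continuous_measurable_fun.
apply: measurable_funD; apply: measurable_funM.
- exact: measurableT_comp measurable_fst m1.
- exact: mc.
- exact: measurableT_comp measurable_snd m1.
- exact: mc.
Qed.

Let f_le z : (`|f z| <= (\1_circ z.2)%:E)%E.
Proof.
rewrite /f /= lee_fin normrM (ger0_norm (_ : 0 <= \1_circ _))//.
by rewrite ler_piMl// /wave normrM mulr_ile1 ?cos_max ?sin_max.
Qed.

Let f_integrable : (P \x mu)%E.-integrable setT f.
Proof.
apply/(integrable12ltyP _ _ mf).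
apply: (@le_lt_trans _ _ (\int[P]_x (twopi)%:E)%E); last first.
  rewrite integral_cst//; apply: lte_mul_pinfty => //.
    by rewrite lee_fin ltW// twopi_gt0.
  by apply: (@le_lt_trans _ _ 1%E); [exact: probability_le1|exact: ltry].
have mfa : measurable_fun setT (abse \o f) by exact: measurableT_comp.
apply: ge0_le_integral => //.
  by move=> x _; exact: integral_ge0.
  apply: (measurable_fun_fubini_tonelli_F (abse \o f) mfa) => z.
  exact: abse_ge0.
move=> x _.
apply: (@le_trans _ _ (\int[mu]_y (\1_circ y)%:E)%E).
  apply: ge0_le_integral => //.
    exact: (measurableT_comp mfa (pair1_measurable x)).
  by apply/measurable_EFinP; exact: measurable_indic.
rewrite integral_indic// setIT.
have h : (lebesgue_measure circ <= twopi%:E)%E.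
  by rewrite lebesgue_measure_itv/= lte_fin twopi_gt0 sube0.
exact: h.
Qed.

Let inner w : (\int[mu]_y f (w, y))%E = (wave_int (Y w))%:E.
Proof.
rewrite /wave_int fineK; last first.
  apply: integrable_fin_num => //.
  by apply: circle_integrable; exact: continuous_wave.
rewrite [RHS]integral_mkcond; apply: eq_integral => y _.
by rewrite restrict_EFin patch_indic.
Qed.

(** A by-product of Fubini: the function is a marginal integral of the integrable [f]. *)
Lemma measurable_wave_int_comp :
  measurable_fun [set: T] (fun w => wave_int (Y w)).
Proof.
apply/measurable_EFinP.
rewrite (_ : EFin \o _ = fun w => (\int[mu]_y f (w, y))%E).
  exact: (measurable_fubini_F f_integrable).
by apply/funext => w; rewrite inner.
Qed.

Lemma Fubini_wave : \int[P]_w wave_int (Y w) =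
  \int[mu]_(t in circ) (\int[P]_w wave (Y w) t).
Proof.
rewrite /Rintegral; congr fine.
transitivity (\int[P]_w \int[mu]_y f (w, y))%E.
  by apply: eq_integral => w _; rewrite inner.
rewrite (Fubini f_integrable) [RHS]integral_mkcond.
apply: eq_integral => t _; rewrite restrict_EFin patch_indic /=.
have mw : measurable_fun [set: T] (fun w => wave (Y w) t).
  apply: measurable_funM; first exact: measurable_cst.
  apply: measurableT_comp.
    exact: (continuous_measurable_fun (@continuous_sin R)).
  apply: measurable_funD; (apply: measurable_funM; last exact: measurable_cst).
    exact: measurableT_comp measurable_fst mY.
  exact: measurableT_comp measurable_snd mY.
have iw : P.-integrable [set: T] (EFin \o (fun w => wave (Y w) t)).
  apply: (@probability_bounded_integrable _ 1) => // w.
  by rewrite /wave normrM mulr_ile1 ?cos_max ?sin_max.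
rewrite EFinM fineK; last exact: integrable_fin_num.
rewrite muleC -integralZl//; apply: eq_integral => w _.
by rewrite -EFinM mulrC.
Qed.

End Fubini_wave.

Section Semigroup.
Context d (T : measurableType d) (R : realType) (P : probability T R).
Variable X : R -> T -> R * R.
Hypothesis hX : cauchy_process P X.
Implicit Types (x xi : R * R) (b : nat -> R) (t : R).

Let mX t : 0 <= t -> measurable_fun [set: T] (X t).
Proof. exact: (levy_measurable hX.1). Qed.

Lemma fine_expectation (h : T -> R) : fine 'E_P[h] = \int[P]_w h w.
Proof. by rewrite unlock. Qed.

Lemma cauchy_cos_sin t xi : 0 <= t ->
  \int[P]_w cos (dot xi (X t w)) = expR (- (t * enorm xi)) /\
  \int[P]_w sin (dot xi (X t w)) = 0.
Proof.
move=> t0; case: hX => _ /(_ t xi t0).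
by rewrite /cexpectation !fine_expectation => -[<- <-].
Qed.

(** Expand by the addition formula. The characteristic function is real, so the term in
    [sin (dot xi (X t w))] has mean zero. *)
Lemma cauchy_sin_shift t xi (a : R) : 0 <= t ->
  \int[P]_w sin (a + dot xi (X t w)) = expR (- (t * enorm xi)) * sin a.
Proof.
move=> t0; have [hc hs] := cauchy_cos_sin xi t0.
have mdot : measurable_fun [set: T] (fun w => dot xi (X t w)).
  have mXt := mX t0.
  apply: measurable_funD; (apply: measurable_funM; first exact: measurable_cst).
    exact: measurableT_comp measurable_fst mXt.
  exact: measurableT_comp measurable_snd mXt.
have ic : P.-integrable [set: T] (EFin \o (fun w => cos (dot xi (X t w)))).
  apply: (@probability_bounded_integrable _ _ _ _ _ 1) => [|w];
    last exact: cos_max.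
  apply: measurableT_comp mdot.
  exact: (continuous_measurable_fun (@continuous_cos R)).
have is0 : P.-integrable [set: T] (EFin \o (fun w => sin (dot xi (X t w)))).
  apply: (@probability_bounded_integrable _ _ _ _ _ 1) => [|w];
    last exact: sin_max.
  apply: measurableT_comp mdot.
  exact: (continuous_measurable_fun (@continuous_sin R)).
transitivity (\int[P]_w (sin a * cos (dot xi (X t w)) +
    cos a * sin (dot xi (X t w)))).
  by apply: eq_Rintegral => w _; rewrite sinD.
rewrite RintegralD//; last 2 first.
- exact: (integrableZl measurableT (sin a) ic).
- exact: (integrableZl measurableT (cos a) is0).
by rewrite !RintegralZl// hc hs mulr0 addr0 mulrC.
Qed.

Let mshift t n x : 0 <= t ->
  measurable_fun [set: T] (fun w => (8 ^+ n : R) *: (x + X t w)).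
Proof.
move=> t0; have mXt := mX t0.
apply: measurable_fun_pair => /=.
  apply: measurable_funM; first exact: measurable_cst.
  apply: measurable_funD; first exact: measurable_cst.
  exact: measurableT_comp measurable_fst mXt.
apply: measurable_funM; first exact: measurable_cst.
apply: measurable_funD; first exact: measurable_cst.
exact: measurableT_comp measurable_snd mXt.
Qed.

Lemma measurable_wave_int8 t n x : 0 <= t ->
  measurable_fun [set: T] (fun w => wave_int8 n (x + X t w)).
Proof. by move=> t0; exact: (measurable_wave_int_comp P (mshift n x t0)). Qed.

Lemma integrable_wave_int8 t n x : 0 <= t ->
  P.-integrable [set: T] (EFin \o (fun w => wave_int8 n (x + X t w))).
Proof.
move=> t0; apply: (@probability_bounded_integrable _ _ _ _ _ (pi *+ 2)).
  exact: measurable_wave_int8.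
by move=> w; exact: wave_int_bounded.
Qed.

(** All plane waves averaged here have frequency of norm [8 ^ n], hence the same eigenvalue, which
    comes out of the circle integral after Fubini. *)
Lemma semigroup_wave_int8 t n x : 0 <= t ->
  \int[P]_w wave_int8 n (x + X t w) = expR (- (t * 8 ^+ n)) * wave_int8 n x.
Proof.
move=> t0; rewrite /wave_int8 (Fubini_wave P (mshift n x t0)).
rewrite /wave_int -RintegralZl//; last first.
  by apply: circle_integrable; exact: continuous_wave.
apply: eq_Rintegral => s _.
pose xi : R * R := 8 ^+ n *: dir s.
have -> : expR (- (t * 8 ^+ n)) * wave (8 ^+ n *: x) s =
    cos s * \int[P]_w sin (dot (8 ^+ n *: x) (dir s) + dot xi (X t w)).
  rewrite cauchy_sin_shift// enorm_dir ?exprn_ge0// /wave.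
  by rewrite mulrCA.
rewrite -RintegralZl//.
  apply: eq_Rintegral => w _; rewrite /wave; congr (_ * sin _).
  by rewrite /xi /dot /= /GRing.scale /=; ring.
apply: (@probability_bounded_integrable _ _ _ _ _ 1) => [|w];
  last exact: sin_max.
apply: measurableT_comp.
  exact: (continuous_measurable_fun (@continuous_sin R)).
have mXt := mX t0.
apply: measurable_funD; first exact: measurable_cst.
apply: measurable_funD; (apply: measurable_funM; first exact: measurable_cst).
  exact: measurableT_comp measurable_fst mXt.
exact: measurableT_comp measurable_snd mXt.
Qed.

(** Finite sums follow by linearity. Convergence of the partial sums is uniform in the point because
    [b] tends to 0, so it passes through the expectation. *)
Lemma semigroup_wave_series b (M : R) t x : (forall n, `|b n| <= M) ->
  b @ \oo --> 0 -> 0 <= t ->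
  semigroup P X t (wave_series b) x =
  wave_series (fun n => expR (- (t * 8 ^+ n)) * b n) x.
Proof.
move=> bM b0 t0; rewrite /semigroup fine_expectation.
pose K : R := 4 * (5 * (pi *+ 2)).
have K0 : 0 < K by rewrite mulr_gt0// wave_bound_gt0.
have e1 n : `|expR (- (t * 8 ^+ n))| <= 1.
  by rewrite ger0_norm ?expR_ge0// expR_le1 oppr_le0 mulr_ge0 ?exprn_ge0.
have ble n : `|expR (- (t * 8 ^+ n)) * b n| <= `|b n|.
  by rewrite normrM ler_piMl.
have e_M n : `|expR (- (t * 8 ^+ n)) * b n| <= M by apply: le_trans (bM n).
have mb : measurable_fun [set: T] (fun w => wave_series b (x + X t w)).
  apply: (measurable_fun_cvg (h := fun m w =>
      \sum_(n < m) b n * wave_int8 n (x + X t w))).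
    move=> m; apply: measurable_sum => n.
    apply: measurable_funM; first exact: measurable_cst.
    exact: measurable_wave_int8.
  move=> w _; have : series (fun n => b n * wave_int8 n (x + X t w)) @ \oo -->
      wave_series b (x + X t w) := is_cvg_wave_series bM.
  by rewrite seriesEord.
have ib : P.-integrable [set: T] (EFin \o (fun w => wave_series b (x + X t w))).
  apply: (@probability_bounded_integrable _ _ _ _ _ (M * K)) => // w.
  by apply: (wave_series_bound bM) => m; exact: wave_int8_sum_le.
have isum N : P.-integrable [set: T]
    (EFin \o (fun w => \sum_(n < N) b n * wave_int8 n (x + X t w))).
  rewrite (_ : _ \o _ = fun w =>
      (\sum_(n < N) (b n * wave_int8 n (x + X t w))%:E)%E).
    apply: integrable_sum => // n _.
    exact: (integrableZl measurableT (b n) (integrable_wave_int8 n x t0)).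
  by apply/funext => w /=; rewrite sumEFin.
have Esum N : \int[P]_w (\sum_(n < N) b n * wave_int8 n (x + X t w)) =
    \sum_(n < N) (expR (- (t * 8 ^+ n)) * b n) * wave_int8 n x.
  elim: N => [|N IH].
    under eq_Rintegral do rewrite big_ord0.
    by rewrite big_ord0 Rintegral_cst// mul0r.
  under eq_Rintegral do rewrite big_ord_recr.
  rewrite RintegralD//; last first.
    exact: (integrableZl measurableT (b N) (integrable_wave_int8 N x t0)).
  rewrite IH RintegralZl//; last exact: integrable_wave_int8.
  by rewrite semigroup_wave_int8// big_ord_recr /= mulrCA mulrA.
apply/eqP; rewrite -subr_eq0 -normr_le0; apply/ler_addgt0Pr => e e0.
rewrite add0r.
have [|N hN] := @cvg0_tail _ b (e / 2 / K) b0; first by rewrite !divr_gt0.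
have ap (y : R * R) := wave_series_approx bM hN (fun m => wave_int8_sum_le m y).
(* The exponential factors are at most 1, so the same [N] serves for the damped series; both sides
   are then within [e / 2] of the same finite sum. *)
have ap2 := wave_series_approx e_M (fun n Nn => le_trans (ble n) (hN n Nn))
  (fun m => wave_int8_sum_le m x).
have KE : e / 2 / K * K = e / 2 by rewrite divfK// gt_eqF.
rewrite -/K KE in ap ap2.
have : `|\int[P]_w wave_series b (x + X t w) -
    \sum_(n < N) (expR (- (t * 8 ^+ n)) * b n) * wave_int8 n x| <= e / 2.
  rewrite -Esum -RintegralB//.
  have idiff : P.-integrable [set: T] (EFin \o (fun w =>
      wave_series b (x + X t w) - \sum_(n < N) b n * wave_int8 n (x + X t w))).
    exact: (integrableB measurableT ib (isum N)).
  apply: (le_trans (@le_normr_Rintegral _ _ _ P _ _ _ idiff)) => //.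
  apply: (@le_trans _ _ (\int[P]_w (e / 2))).
    apply: le_Rintegral => //; last exact: finite_measure_integrable_cst.
    exact: integrable_norm.
  have P1 : fine (P [set: T]) = 1 by rewrite probability_setT.
  by rewrite Rintegral_cst// -[leRHS]mulr1 -P1.
move: ap2; rewrite !ler_norml => /andP[? ?] /andP[? ?].
by apply/andP; split; lra.
Qed.

End Semigroup.

(** * The function outside the Lipschitz class *)

Section Counterexample.
Variable R : realType.

(** Here [harmonic n] is [1 / (n + 1)]: it tends to 0, which puts the series in the domain, but is
    not summable, which breaks the Lipschitz property. *)
Definition lacunary (n : nat) : R := harmonic n / 8 ^+ n.

Lemma harmonic_le1 n : harmonic n <= 1 :> R.
Proof. by rewrite /harmonic invf_le1// ler1n. Qed.

Lemma normr_harmonic n : `|harmonic n : R| <= 1.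
Proof. by rewrite ger0_norm ?harmonic_ge0// harmonic_le1. Qed.

Lemma lacunary_le n : `|lacunary n| <= (8 ^+ n)^-1.
Proof.
rewrite /lacunary normrM ger0_norm ?harmonic_ge0//.
by rewrite ger0_norm ?invr_ge0 ?exprn_ge0// ler_piMl ?harmonic_le1//.
Qed.

Lemma lacunary_le1 n : `|lacunary n| <= 1.
Proof.
apply: le_trans (lacunary_le n) _.
by rewrite invf_le1 ?exprn_gt0// exprn_ege1// ler1n.
Qed.

Lemma lacunary_cvg0 : lacunary @ \oo --> 0.
Proof.
apply: norm_cvg0; apply: (@squeeze_cvgr _ _ _ _ (cst 0) harmonic).
- near=> n; rewrite normr_ge0/= /lacunary normrM ger0_norm ?harmonic_ge0//.
  rewrite ger0_norm ?invr_ge0 ?exprn_ge0// ler_piMr ?harmonic_ge0//.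
  by rewrite invf_le1 ?exprn_gt0// exprn_ege1// ler1n.
- exact: cvg_cst.
- exact: cvg_harmonic.
Unshelve. all: by end_near. Qed.

Definition oscillating : R * R -> R := wave_series lacunary.

(** A Lipschitz constant [L] would bound the harmonic sums by [L + K]. At [(u, 0)] with [u = 8^-N],
    each term [n <= N] is at least [u * harmonic n], as [8 ^ n * u <= 1], while the tail has
    coefficients at most [u] and so is at most [u * K]. *)
Lemma oscillating_not_lipschitz : ~ lipschitz_continuous oscillating.
Proof.
move=> [L hL]; pose K : R := 4 * (5 * (pi *+ 2)).
apply: (@dvg_harmonic R); apply: nondecreasing_is_cvgn.
  apply/nondecreasing_seqP => n.
  by rewrite -subr_ge0 [X in 0 <= X]seriesSB harmonic_ge0.
exists (L + K) => _ [N _ <-].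
apply: (@le_trans _ _ (\sum_(n < N.+1) harmonic n)).
  by rewrite seriesEord/= big_ord_recr/= lerDl harmonic_ge0.
pose u : R := (8 ^+ N)^-1.
have u0 : 0 < u by rewrite invr_gt0 exprn_gt0.
have f0 : oscillating 0 = 0.
  apply/normr0_eq0/eqP; rewrite eq_le normr_ge0 andbT -[leRHS](mulr0 1).
  apply: wave_series_bound; first exact: lacunary_le1.
  move=> m; rewrite big1// => n _.
  by rewrite /wave_int8 scaler0 wave_int0 normr0.
have fu : `|oscillating (u, 0)| <= L * u.
  have := hL (u, 0) 0; rewrite f0 !subr0.
  by rewrite [enorm _]/enorm /dot/= mul0r addr0 -expr2 sqrtr_sqr (gtr0_norm u0).
have tail n : (N.+1 <= n)%N -> `|lacunary n| <= u.
  move=> Nn; apply: le_trans (lacunary_le n) _.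
  rewrite lef_pV2 ?posrE ?exprn_gt0//.
  by apply: ler_weXn2l; [rewrite ler1n|exact: ltnW].
have := wave_series_approx lacunary_le1 tail
  (fun m => wave_int8_sum_le m (u, 0)).
rewrite -/K -/oscillating.
have : u * \sum_(n < N.+1) harmonic n <=
    \sum_(n < N.+1) lacunary n * wave_int8 n (u, 0).
  rewrite mulr_sumr; apply: ler_sum => n _.
  have v01 : 0 <= 8 ^+ n * u <= 1.
    rewrite mulr_ge0 ?exprn_ge0 ?(ltW u0)//= /u ler_pdivrMr ?exprn_gt0// mul1r.
    by apply: ler_weXn2l; [rewrite ler1n|rewrite -ltnS].
  have := wave_int_ge v01.
  have -> : (8 ^+ n * u, 0) = 8 ^+ n *: (u, 0) :> R * R.
    by congr (_, _); rewrite /= scaler0.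
  rewrite -/(wave_int8 n (u, 0)) => h.
  have h8 : 0 < 8 ^+ n :> R by rewrite exprn_gt0.
  (* The factor [pi / 2 >= 1] from [wave_int_ge] is dropped. *)
  have h2 : 8 ^+ n * u <= wave_int8 n (u, 0).
    apply: le_trans h; rewrite -mulrA ler_peMr ?pihalf_ge1//.
    by rewrite mulr_ge0// ltW.
  rewrite mulrC /lacunary -mulrA ler_wpM2l ?harmonic_ge0//.
  by rewrite ler_pdivlMl.
rewrite mulrC.
move: fu; rewrite !ler_norml => /andP[_ h1] h2 /andP[h3 _].
rewrite -(ler_pM2r u0); lra.
Qed.

(** With [y = t * 8 ^ n] this is the relative error of the difference quotient on one dilate. The
    bound [y] serves low frequencies, the bound 1 high ones. The former rests on
    [expR (- y) * (1 + y) <= 1]. *)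
Lemma expR_defect (y : R) : 0 < y ->
  0 <= (expR (- y) - 1) / y + 1 /\ (expR (- y) - 1) / y + 1 <= y /\
  (expR (- y) - 1) / y + 1 <= 1.
Proof.
move=> y0.
have h1 : 1 - y <= expR (- y) by exact: expR_ge1Dx.
have h2 : expR (- y) <= 1 by rewrite expR_le1 oppr_le0 ltW.
have h3 : expR (- y) * (1 + y) <= 1.
  have := expR_ge1Dx y; rewrite -(ler_pM2l (expR_gt0 (- y))).
  by rewrite -expRD addNr expR0.
have -> : (expR (- y) - 1) / y + 1 = (expR (- y) - 1 + y) / y.
  by field; rewrite gt_eqF.
split; first by rewrite divr_ge0 ?(ltW y0)//; lra.
split; rewrite ler_pdivrMr//; last by lra.
have := expR_gt0 (- y); set E := expR _ in h1 h2 h3 * => E0; nra.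
Qed.

(** * Convergence of the difference quotients *)

Context d (Omega : measurableType d) (P : probability Omega R).
Variable X : R -> Omega -> R * R.
Hypothesis hX : cauchy_process P X.

(** The generator multiplies the [n]-th dilate by [- 8 ^ n], which cancels the denominator in
    [lacunary]. *)
Definition oscillating_image : R * R -> R :=
  wave_series (fun n => - harmonic n).

Lemma difference_quotient (t : R) x : 0 < t ->
  t^-1 * (semigroup P X t oscillating x - oscillating x) - oscillating_image x =
  wave_series (fun n => harmonic n *
    ((expR (- (t * 8 ^+ n)) - 1) / (t * 8 ^+ n) + 1)) x.
Proof.
move=> t0.
rewrite (semigroup_wave_series hX x lacunary_le1 lacunary_cvg0 (ltW t0)).
rewrite -(@wave_series_lin _ _ _ _ _ _ 1)//; last 3 first.
- move=> n; rewrite normrM mulr_ile1// ?lacunary_le1//.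
  by rewrite ger0_norm ?expR_ge0// expR_le1 oppr_le0 mulr_ge0 ?exprn_ge0 ?ltW.
- exact: lacunary_le1.
- by move=> n; rewrite normrN normr_harmonic.
congr wave_series; apply/funext => n; rewrite /lacunary.
by field; rewrite gt_eqF ?exprn_gt0// gt_eqF.
Qed.

Lemma difference_quotient_le (e : R) : 0 < e ->
  exists2 r : R, 0 < r & forall t x, 0 < t -> t <= r ->
    `|t^-1 * (semigroup P X t oscillating x - oscillating x) -
      oscillating_image x| <= e.
Proof.
move=> e0; pose K : R := 4 * (5 * (pi *+ 2)).
have K0 : 0 < K by rewrite mulr_gt0// wave_bound_gt0.
have eK0 : 0 < e / K by rewrite divr_gt0.
have [N hN] := cvg0_tail cvg_harmonic eK0.
(* For [n >= N] the harmonic coefficient is at most [e / K]; for [n < N] this radius makes the error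
   [t * 8 ^ n] at most [e / K]. Summation multiplies by at most [K], uniformly in [x]. *)
exists (e / K / 8 ^+ N) => [|t x t0 tr]; first by rewrite divr_gt0// exprn_gt0.
rewrite difference_quotient//.
have -> : e = e / K * K by rewrite divfK// gt_eqF.
apply: wave_series_bound => [n|m]; last exact: wave_int8_sum_le.
have y0 : 0 < t * 8 ^+ n by rewrite mulr_gt0// exprn_gt0.
have [k0 [ky k1]] := expR_defect y0.
rewrite normrM (ger0_norm k0).
have [Nn|nN] := leqP N n.
  by apply: le_trans (hN n Nn); rewrite ler_piMr.
apply: le_trans (ler_piMl k0 (normr_harmonic n)) _.
apply: le_trans ky _.
move: tr; rewrite ler_pdivlMr ?exprn_gt0//; apply: le_trans.
rewrite ler_pM2l//; apply: ler_weXn2l; [by rewrite ler1n|exact: ltnW].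
Qed.

Lemma generator_graph_oscillating :
  generator_graph P X oscillating oscillating_image.
Proof.
split.
- exact: wave_series_Cinfty lacunary_le1 lacunary_cvg0.
- apply: (@wave_series_Cinfty _ _ 1).
    by move=> n; rewrite normrN normr_harmonic.
  by rewrite -[0]oppr0; apply: cvgN; exact: cvg_harmonic.
set S := fun t : R => _.
have S0 t : (0 <= S t)%E.
  apply: le_trans (_ : _ <= _)%E (ereal_sup_ubound _); last by exists 0.
  by rewrite lee_fin.
have Se (e : R) : 0 < e -> \forall t \near 0^'+, (S t <= e%:E)%E.
  move=> e0; have [r r0 h] := difference_quotient_le e0.
  near=> t.
  apply: ge_ereal_sup => _ [x _ <-]; rewrite lee_fin; apply: h.
    by near: t; exact: nbhs_right_gt.
  by near: t; exact: nbhs_right_le.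
(* The supremum norm takes extended real values, so its finiteness near 0 precedes the reduction to
   a real limit. *)
have fS : \forall t \near 0^'+, S t \is a fin_num.
  apply: filterS (Se 1 ltr01) => t St.
  by rewrite ge0_fin_numE// (le_lt_trans St)// ltry.
apply/fine_cvgP; split => //.
apply/cvgr0Pnorm_le => e e0.
near=> t.
have tf : S t \is a fin_num by near: t.
rewrite /= ger0_norm ?fine_ge0// -lee_fin fineK//.
by near: t; exact: Se.
Unshelve. all: by end_near. Qed.

End Counterexample.

Theorem theorem5p2 (R : realType) (d : measure_display)
    (Omega : measurableType d) (P : probability Omega R)
    (X : R -> Omega -> R * R) (hX : cauchy_process P X) :
  exists f : R * R -> R,
    generator_domain P X f /\ ~ lipschitz_continuous f.
Proof.
exists (@oscillating R); split; last exact: oscillating_not_lipschitz.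
by exists (@oscillating_image R); exact: generator_graph_oscillating.
Qed.
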